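(* Let $p \in B_1$ and suppose that $p$ is $T^{(1)}_\infty$-evolvable. Then $$T^{(1)}_\infty(p) = K_2K_3\cdots K_{n+1}(p),$$ where $K_{n+1}$ is applied first and $K_2$ last.
   Context: Fix integers $n\ge 1$, $L\ge 1$. For $1\le r\le n$, $l\ge 1$, let $B^{r,l}$ be the set of semistandard tableaux of rectangular shape with $r$ rows and $l$ columns and entries in $\{1,\ldots,n+1\}$; so $B^{1,1}=\{1,\ldots,n+1\}$. For a semistandard tableau $T$ and a letter $x$, $T\leftarrow x$ denotes Schensted row insertion ($x$ bumps the smallest entry of the first row strictly larger than $x$, the bumped entry is inserted into the next row, and so on; if there is no such entry the letter is appended at the end of the row), and $x\rightarrow T$ denotes column insertion ($x$ bumps the smallest entry of the first column that is $\ge x$, the bumped entry is inserted into the next column, and so on; if there is no such entry the letter is appended at the bottom of the column). The combinatorial $R$ is the bijection $R:B^{r,l}\otimes B^{1,1}\to B^{1,1}\otimes B^{r,l}$ ($\otimes$ is a formal Cartesian product) determined by $R(b\otimes c)=c'\otimes b'$ iff $(c\rightarrow b)=(b'\leftarrow c')$; we also write $b\otimes c\simeq c'\otimes b'$. The local energy $H(b\otimes c)$ is $0$ if this common tableau has shape $(l+1,l^{r-1})$ and $1$ if it has shape $(l^r,1)$. A path is an element $p=b_1\otimes\cdots\otimes b_L$ of $B=(B^{1,1})^{\otimes L}$, also written as a word $b_1\ldots b_L$. For $v\in B^{r,l}$ put $v_0=v$ and recursively $v_{k-1}\otimes b_k\simeq b'_k\otimes v_k$, $e_k=H(v_{k-1}\otimes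 b_k)$ for $k=1,\ldots,L$; write $v'(v;p)=v_L$, $p'(v;p)=b'_1\otimes\cdots\otimes b'_L$, $e_k(v;p)=e_k$. The path $p$ is $T^{(r)}_l$-evolvable if there is $v\in B^{r,l}$ with $v=v'(v;p)$ and, moreover, $p'(v;p)$ and all $e_k(v;p)$ are the same for all such $v$. Then $T^{(r)}_l(p)=p'(v;p)$ for any such $v$. $T^{(1)}_\infty$ denotes $T^{(1)}_l$ with $l$ sufficiently large, and $T^{(1)}_\infty$-evolvable means $T^{(1)}_l$-evolvable for sufficiently large $l$. $B_1$ is the set of paths $p\in B$ with $\#(1)\ge \#(a)$ for all $2\le a\le n+1$, where $\#(a)$ is the number of letters $a$ in $p$. For $a=2,\ldots,n+1$ the map $K_a:B_1\to B_1$ is defined on a word $p=b_1b_2\ldots b_L$ by: (i) ignore all letters except $1$ and $a$; (ii) connect every adjacent pair $a1$ (not $1a$) by an arc, where $1$ is on the right of $a$ cyclically (positions are considered cyclically modulo $L$); (iii) repeat (ii), ignoring already connected pairs, until all $a$'s are connected to some $1$; (iv) exchange $a$ and $1$ within each connected pair. *)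

(* Defs.v *)
From mathcomp Require Import all_boot.

Set Implicit Arguments.
Unset Strict Implicit.
Unset Printing Implicit Defensive.

(* The alphabet {1, ..., n+1}: the ordinal i stands for the letter i+1. *)
Notation letter n := 'I_n.+1.

Definition one {n : nat} : letter n := ord0.

Section Tableaux.
Variable n : nat.

(* A tableau is given as the sequence of its rows, top to bottom. *)
Definition tableau := seq (seq (letter n)).

Definition shape_of (T : tableau) : seq nat := [seq size row | row <- T].

(* Exchanges the list of rows and the list of columns. *)
Definition transpose (T : tableau) : tableau :=
  mkseq (fun j => [seq nth one row j | row <- T & j < size row])
        (size (head [::] T)).

Definition semistandard (T : tableau) : bool :=
  all (sorted (fun x y : letter n => x <= y)) T &&
  all (sorted (fun x y : letter n => x < y)) (transpose T).

(* Insertion in the list of lines T, where x bumps the first entry y of a line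
   such that gt x y; as lines are sorted, this is the smallest such entry. *)
Fixpoint insert (gt : rel (letter n)) (T : tableau) (x : letter n) : tableau :=
  if T is s :: T' then
    let k := find (gt x) s in
    if k < size s then set_nth one s k x :: insert gt T' (nth one s k)
    else rcons s x :: T'
  else [:: [:: x]].

(* T <- x *)
Definition row_insert (T : tableau) (x : letter n) : tableau :=
  insert (fun x y => x < y) T x.

(* x -> T *)
Definition col_insert (x : letter n) (T : tableau) : tableau :=
  transpose (insert (fun x y => x <= y) (transpose T) x).

End Tableaux.

(* B^{r,l}; the factor B^{1,1} is represented by letter n itself. *)
Definition crystal (n r l : nat) :=
  {t : r.-tuple (l.-tuple (letter n)) | semistandard [seq tval row | row <- t]}.

Definition tab {n r l : nat} (b : crystal n r l) : tableau n :=
  [seq tval row | row <- val b].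

Section Dynamics.
Variables n r l : nat.
Implicit Types (b v w : crystal n r l) (c : letter n) (p : seq (letter n)).

(* R (b (x) c) is the pair (c', b') with (c -> b) = (b' <- c').  For
   1 <= r <= n and 1 <= l there is exactly one such pair, so that the default
   value is irrelevant. *)
Definition combR b c : letter n * crystal n r l :=
  odflt (c, b)
    [pick x : letter n * crystal n r l |
       col_insert c (tab b) == row_insert (tab x.2) x.1].

(* The only possible shapes are (l+1, l^{r-1}) and (l^r, 1). *)
Definition energy b c : nat :=
  if shape_of (col_insert c (tab b)) == l.+1 :: nseq r.-1 l then 0 else 1.

(* v'(v; p) *)
Fixpoint carrier_out v p : crystal n r l :=
  if p is c :: p' then carrier_out (combR v c).2 p' else v.

(* p'(v; p) *)
Fixpoint path_out v p : seq (letter n) :=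
  if p is c :: p' then (combR v c).1 :: path_out (combR v c).2 p' else [::].

(* e_1(v; p), ..., e_L(v; p) *)
Fixpoint energies v p : seq nat :=
  if p is c :: p' then energy v c :: energies (combR v c).2 p' else [::].

Definition evolvable p : Prop :=
  (exists v, v = carrier_out v p) /\
  (forall v w, v = carrier_out v p -> w = carrier_out w p ->
     path_out v p = path_out w p /\ energies v p = energies w p).

(* T^{(r)}_l (p), meaningful only for evolvable p. *)
Definition evolve p : seq (letter n) :=
  if [pick v : crystal n r l | v == carrier_out v p] is Some v
  then path_out v p else p.

End Dynamics.

Arguments evolvable {n} r l p.
Arguments evolve {n} r l p.

Definition Tinf_evolvable {n : nat} (p : seq (letter n)) : Prop :=
  exists l0, forall l, l0 <= l -> evolvable 1 l p.

(* T^{(1)}_infty (p) = q: the eventual value of T^{(1)}_l (p) is q. *)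
Definition Tinf_eq {n : nat} (p q : seq (letter n)) : Prop :=
  exists l0, forall l, l0 <= l -> evolve 1 l p = q.

Definition in_B1 {n : nat} (p : seq (letter n)) : Prop :=
  forall a : letter n, count_mem a p <= count_mem one p.

Section K.
Variables (n : nat) (a : letter n) (p : seq (letter n)).

(* Positions in p are numbered from 0; the arc (i, j) connects the letter a at
   position i with the letter 1 at position j. *)
Definition unconnected (arcs : seq (nat * nat)) : seq nat :=
  [seq i <- iota 0 (size p) |
     (nth one p i \in [:: one; a]) && (i \notin unzip1 arcs ++ unzip2 arcs)].

(* next s i is the cyclic successor of i in s. *)
Definition connect_adjacent (arcs : seq (nat * nat)) : seq (nat * nat) :=
  let s := unconnected arcs in
  arcs ++ [seq (i, next s i) |
             i <- s & (nth one p i == a) && (nth one p (next s i) == one)].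

(* Each round connects at least one a if some is left (for p in B_1), and
   does nothing otherwise, so that size p rounds are enough. *)
Definition all_arcs : seq (nat * nat) := iter (size p) connect_adjacent [::].

Definition K : seq (letter n) :=
  [seq (if i \in unzip1 all_arcs then one
        else if i \in unzip2 all_arcs then a
        else nth one p i) | i <- iota 0 (size p)].

End K.

(* K_2 (K_3 (... (K_{n+1} p))); enum lists the letters in increasing order. *)
Definition K_all {n : nat} (p : seq (letter n)) : seq (letter n) :=
  foldr (fun a q => K a q) p [seq a <- enum 'I_n.+1 | a != one].

(* Main.v *)
From mathcomp Require Import all_boot zify.
Require Import Defs.

Set Implicit Arguments.
Unset Strict Implicit.
Unset Printing Implicit Defensive.

(* For one row, the combinatorial R exchanges the incoming letter c with the
   largest carried letter below c, cyclically.  As long as the carrier holds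
   some letter 1, only the numbers m_a of carried letters a > 1 matter, and the
   carrier acts as a composition of one-colour carriers, first the one of colour
   n+1 and last the one of colour 2: the carrier of colour a, when it holds k
   letters, turns a into 1 (now holding k+1), and 1 into a (now holding k-1) if
   k > 0.  If it starts with as many letters as there are arcs of K_a that cross
   the end of the word, it holds at each position one letter per arc open there,
   because an unconnected 1 is never inside an arc; hence it outputs K_a and
   comes back to its initial content.  These contents for all colours,
   completed by enough letters 1, form a carrier fixed by p, and evolvability
   says that the output of any fixed carrier is the value of T_infty. *)

(** * The combinatorial R on one-row tableaux *)

Section OneRow.
Variable n : nat.
Implicit Types (x y z a c : letter n) (s t p q : seq (letter n)).

Definition leL : rel (letter n) := fun x y => x <= y.

Lemma leL_trans : transitive leL.
Proof. by move=> y x z; apply: leq_trans. Qed.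

Lemma transpose_row s : transpose [:: s] = [seq [:: x] | x <- s].
Proof.
rewrite /transpose /=; apply: (@eq_from_nth _ [::]).
  by rewrite size_mkseq size_map.
move=> i; rewrite size_mkseq => lt_i.
by rewrite nth_mkseq // lt_i (nth_map one).
Qed.

Lemma transpose_column_row x s :
  transpose [seq [:: y] | y <- x :: s] = [:: x :: s].
Proof.
rewrite /transpose /= /mkseq /=; congr [:: _ :: _].
by elim: s => //= y s ->.
Qed.

Lemma transpose_hook x s c :
  transpose ([:: x; c] :: [seq [:: y] | y <- s]) = [:: x :: s; [:: c]].
Proof.
rewrite /transpose /= /mkseq /=; congr [:: _ :: _; _ :: _].
  by elim: s => //= y s ->.
by elim: s => //= y s ->.
Qed.

Lemma semistandard_row s : semistandard [:: s] = sorted leL s.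
Proof.
rewrite /semistandard transpose_row /= andbT.
by rewrite (_ : all _ _ = true) ?andbT //; elim: s.
Qed.

(** Each column is a single letter, and the inserted letter never exceeds it, so the bumping shifts
    the whole row one column to the right. *)
Lemma insert_columns c s : sorted leL (c :: s) ->
  insert (fun x y => x <= y) [seq [:: x] | x <- s] c =
  [seq [:: x] | x <- c :: s].
Proof.
by elim: s c => //= y s IHs c /andP[cy ys]; rewrite /leL in cy; rewrite cy IHs.
Qed.

Lemma col_insert_row x s c : sorted leL (x :: s) ->
  col_insert c [:: x :: s] =
  if c <= x then [:: c :: x :: s] else [:: x :: s; [:: c]].
Proof.
move=> xs_sorted; rewrite /col_insert transpose_row.
have [le_cx|lt_xc] := leqP c x.
  by rewrite insert_columns ?transpose_column_row //=; apply/andP.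
by rewrite /= (ltn_geF lt_xc) /= transpose_hook.
Qed.

Lemma row_insert_append t x : all (fun y => y <= x) t ->
  row_insert [:: t] x = [:: rcons t x].
Proof.
move=> t_le_x; rewrite /row_insert /= -has_find ifN // -all_predC.
by apply: sub_all t_le_x => y /=; rewrite leqNgt.
Qed.

Lemma row_insert_bump t1 t2 x c : all (fun y => y <= x) t1 -> x < c ->
  row_insert [:: t1 ++ c :: t2] x = [:: t1 ++ x :: t2; [:: c]].
Proof.
move=> t1_le_x lt_xc; rewrite /row_insert /=.
have -> : find (fun y : letter n => x < y) (t1 ++ c :: t2) = size t1.
  rewrite find_cat ifN /= ?lt_xc ?addn0 // -all_predC.
  by apply: sub_all t1_le_x => y /=; rewrite leqNgt.
rewrite size_cat addnS leq_addr nth_cat ltnn subnn /=.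
by congr [:: _; _]; elim: t1 {t1_le_x} => //= y t1 ->.
Qed.

Definition row l (v : crystal n 1 l) : seq (letter n) := thead (val v).

Lemma tab_row l (v : crystal n 1 l) : tab v = [:: row v].
Proof.
rewrite /tab /row; by case: v => -[[|s []]].
Qed.

Lemma size_row l (v : crystal n 1 l) : size (row v) = l.
Proof. by rewrite size_tuple. Qed.

Lemma row_sorted l (v : crystal n 1 l) : sorted leL (row v).
Proof. by rewrite -semistandard_row -tab_row; case: v. Qed.

Lemma row_inj l : injective (@row l).
Proof.
move=> v w eq_vw; apply: val_inj; apply: val_inj => /=.
have inj_tval : injective (@tval l (letter n)) by apply: val_inj.
by apply: (inj_map inj_tval); rewrite -![map _ _]/(tab _) !tab_row eq_vw.
Qed.

Lemma row_surj l s : size s = l -> sorted leL s ->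
  exists v : crystal n 1 l, row v = s.
Proof.
move=> s_l s_sorted; pose t := tcast s_l (in_tuple s).
have tE : tval t = s by rewrite val_tcast.
have ss_t : semistandard [seq tval r | r <- [tuple t]].
  by rewrite /= tE semistandard_row.
by exists (exist _ [tuple t] ss_t).
Qed.

Lemma sorted_split s c : sorted leL s ->
  s = [seq y : letter n <- s | y < c] ++ [seq y : letter n <- s | c <= y].
Proof.
elim: s => //= y s IHs ys; have [lt_yc|le_cy] := ltnP y c.
  by rewrite /= -IHs ?(path_sorted ys).
have ge_s : all (fun z : letter n => c <= z) s.
  apply: sub_all (order_path_min leL_trans ys) => z; exact: leq_trans.
rewrite (eq_in_filter (_ : {in s, _ =1 pred0})); last first.
  by move=> z /(allP ge_s); rewrite leqNgt => /negPf.
by rewrite filter_pred0 /=; congr (_ :: _); apply/esym/all_filterP.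
Qed.

(** This rules out the default value of [combR]. If [c] is at most the first letter, [c] enters in
    front and the last letter of the lengthened row serves as [x]. Otherwise [x] is the largest
    letter below [c] and [w] has [c] in its place, so that row insertion of [x] bumps [c] again. *)
Lemma combR_exists l (v : crystal n 1 l) c : 0 < l ->
  exists x (w : crystal n 1 l), col_insert c (tab v) = row_insert (tab w) x.
Proof.
rewrite tab_row -{1}(size_row v); have := row_sorted v; have := size_row v.
case: (row v) => // y s sz_s ys _.
rewrite col_insert_row //; have [le_cy|lt_yc] := leqP c y.
  have cys : sorted leL (c :: y :: s) by apply/andP.
  have := cys; rewrite lastI -cats1 sorted_pairwise; last exact: leL_trans.
  rewrite pairwise_cat allrel1r => /and3P[bl_le bl_sorted _].
  have [||w wE] := @row_surj l (belast c (y :: s)).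
  - by rewrite size_belast.
  - by rewrite sorted_pairwise //; apply: leL_trans.
  by exists (last c (y :: s)), w; rewrite tab_row wE row_insert_append ?cats1.
move: sz_s.
have sE := sorted_split c ys; move: (ys); rewrite {1}sE.
have : [seq z : letter n <- y :: s | z < c] != [::] by rewrite /= lt_yc.
have := filter_all (fun z : letter n => z < c) (y :: s).
have := filter_all (fun z : letter n => c <= z) (y :: s).
move: sE; set s1 := filter _ _; set s2 := filter _ _; move: s1 s2 => s1 s2.
case/lastP: s1 => // s1 x ->; rewrite size_cat size_rcons => s2_ge.
rewrite all_rcons => /andP[lt_xc s1_lt] _.
rewrite sorted_pairwise; last exact: leL_trans.
rewrite cat_rcons pairwise_cat allrel_consr.
move=> /and3P[/andP[s1_le_x allrel12] s1_sorted xs2_sorted] sz_l.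
have [||w wE] := @row_surj l (s1 ++ c :: s2).
- by rewrite size_cat /=; lia.
- rewrite sorted_pairwise; last exact: leL_trans.
  rewrite pairwise_cat allrel_consr s1_sorted allrel12.
  rewrite !andbT /=; apply/and3P; split.
  + by apply: sub_all s1_lt => z /ltnW.
  + by [].
  by case/andP: xs2_sorted.
by exists x, w; rewrite tab_row wE row_insert_bump.
Qed.

(** All three properties follow from the insertion equation alone, so they hold for whichever pair
    [pick] returns. The test [has] decides whether the search for a letter below [c] wraps around to
    the maximum of the row. *)
Lemma combR_spec l (v : crystal n 1 l) c : 0 < l ->
  let x := (combR v c).1 in let w := (combR v c).2 in
  [/\ perm_eq (x :: row w) (c :: row v), x \in row v &
      {in row v, forall y, if has (fun z => z < c) (row v)
                           then x < c /\ (y < c -> y <= x) else y <= x}].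
Proof.
move=> l_gt0; rewrite /combR; case: pickP => [[x w]|none]; last first.
  have [x [w xwE]] := combR_exists v c l_gt0.
  by have /eqP := none (x, w).
rewrite /= !tab_row => /eqP.
have := size_row v; have := row_sorted v; have := row_sorted w.
case: (row v) => [|y s] ws ys sz_s; first by rewrite -sz_s in l_gt0.
move: (row w) ws => t t_sorted; rewrite col_insert_row //.
rewrite /row_insert /=; have [le_cy|lt_yc] := leqP c y.
  (* The common tableau has one row here, so [x] bumps nothing and is the last letter of
     [c :: y :: s]. *)
  case: ifP => // _ [cysE].
  have cys : sorted leL (c :: y :: s) by apply/andP.
  have t_le_x : all (fun z => leL z x) t.
    move: cys; rewrite cysE sorted_pairwise; last exact: leL_trans.
    by rewrite -cats1 pairwise_cat allrel1r => /and3P[].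
  have y_min : {in y :: s, forall z, y <= z}.
    move=> z; rewrite inE => /predU1P[-> //|].
    by move/allP: (order_path_min leL_trans ys); apply.
  split.
  - by rewrite cysE perm_sym perm_rcons.
  - by move: (congr1 (last c) cysE); rewrite last_rcons /= => <-; apply: mem_last.
  move=> z zs; rewrite orFb ifN; last first.
    apply/hasPn => u us; rewrite -leqNgt (leq_trans le_cy) //.
    by rewrite y_min // inE us orbT.
  have : z \in rcons t x by rewrite -cysE inE zs orbT.
  by rewrite mem_rcons inE => /predU1P[-> //|/(allP t_le_x)].
(* The common tableau has two rows here, so [x] bumps [c] out of [t], and the two carriers differ
   only at that place. *)
case: ifP => // lt_k; set k := find _ t in lt_k * => E.
have lt_xc : x < c.
  by case: E => _ ->; apply: (@nth_find _ one (fun u : letter n => x < u)); rewrite has_find.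
have tE : t = take k t ++ c :: drop k.+1 t.
  by case: E => _ ->; rewrite -drop_nth // cat_take_drop.
have : y :: s = take k t ++ x :: drop k.+1 t.
  by case: E; rewrite set_nthE lt_k.
move: (take k t) (drop k.+1 t) tE => t1 t2 tE sE; rewrite sE tE.
move: t_sorted ys; rewrite sE tE.
rewrite !sorted_pairwise; try exact: leL_trans.
rewrite !pairwise_cat /= !allrel_consr.
move=> /and4P[_ _ c_le_t2 _] /and4P[/andP[t1_le_x _] _ _ _].
split.
- by apply/permP=> P; rewrite /= !count_cat /=; lia.
- by rewrite mem_cat mem_head orbT.
move=> z zs; split=> // lt_zc; move: zs; rewrite mem_cat inE.
case/or3P => [/(allP t1_le_x)//|/eqP-> //|/(allP c_le_t2)].
by rewrite /leL leqNgt lt_zc.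
Qed.

End OneRow.

(** * One-colour carriers and their composition *)

Section Machines.
Variable n : nat.
Implicit Types (x y z a c : letter n) (s t p q ls : seq (letter n)).
Implicit Types (k : nat) (m : letter n -> nat).

Definition ball_step a k c : letter n * nat :=
  if c == a then (one, k.+1)
  else if (c == one) && (0 < k) then (a, k.-1) else (c, k).

Fixpoint ball_run a k q : seq (letter n) * nat :=
  if q is c :: q' then
    let r := ball_run a (ball_step a k c).2 q' in
    ((ball_step a k c).1 :: r.1, r.2)
  else ([::], k).

Lemma ball_step_conserves a k c b : a != one -> b != one ->
  (if b == a then (ball_step a k c).2 else 0) + ((ball_step a k c).1 == b) =
  (if b == a then k else 0) + (c == b).
Proof.
rewrite /ball_step => a1 b1.
have [->|ca] /= := eqVneq c a.
  by rewrite (eq_sym one) (negPf b1) (eq_sym a); case: eqP => _ /=; lia.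
have [->|c1] //= := eqVneq c one.
case: (posnP k) => //= k_gt0; rewrite (eq_sym one) (negPf b1) (eq_sym a).
by case: eqP => _ /=; lia.
Qed.

Lemma ball_run_conserves a k q b : a != one -> b != one ->
  (if b == a then (ball_run a k q).2 else 0) + count_mem b (ball_run a k q).1 =
  (if b == a then k else 0) + count_mem b q.
Proof.
move=> a1 b1; elim: q k => //= c q IHq k.
have := IHq (ball_step a k c).2; have := ball_step_conserves k c a1 b1.
by case: (b == a); lia.
Qed.

Lemma size_ball_run a k q : size (ball_run a k q).1 = size q.
Proof. by elim: q k => //= c q IHq k; rewrite IHq. Qed.

(** Conservation settles every letter except 1, whose count then follows from the length of the
    word. *)
Lemma ball_run_perm a k q : a != one -> (ball_run a k q).2 = k ->
  perm_eq (ball_run a k q).1 q.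
Proof.
move=> a1 kE.
have cnt b : b != one -> count_mem b (ball_run a k q).1 = count_mem b q.
  by move=> b1; have := ball_run_conserves k q a1 b1; rewrite kE; lia.
have cnt1 t : count_mem one t + \sum_(b | b != one) count_mem b t = size t.
  rewrite -(bigD1 one (P := predT) (F := fun b => count_mem b t)) //=.
  elim: t => [|c t IHt] /=; first by rewrite big1.
  rewrite big_split /= IHt (bigD1 c) //= eqxx big1 // => b.
  by rewrite eq_sym => /negPf->.
apply/allP => b _ /=; apply/eqP; have [->|] := eqVneq b one; last exact: cnt.
by have := cnt1 q; rewrite -(size_ball_run a k) -cnt1 (eq_bigr _ cnt) => /addIn.
Qed.

Definition multi_run ls m p :=
  foldr (fun a q => (ball_run a (m a) q).1) p ls.

Fixpoint multi_step ls m c : letter n * (letter n -> nat) :=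
  if ls is a :: ls' then
    let xm := multi_step ls' m c in
    let r := ball_step a (m a) xm.1 in
    (r.1, fun z => if z == a then r.2 else xm.2 z)
  else (c, m).

Lemma eq_multi_run ls m m' p : {in ls, m =1 m'} ->
  multi_run ls m p = multi_run ls m' p.
Proof.
elim: ls => //= a ls IHls mm'; rewrite mm' ?mem_head // IHls // => b b_ls.
by rewrite mm' // inE b_ls orbT.
Qed.

(** Running the carriers one after another on the whole word agrees with sending each letter through
    all carriers in turn. Distinct colours ensure that an update at [a] leaves the other carriers
    alone. *)
Lemma multi_run_cons ls m c p : uniq ls ->
  multi_run ls m (c :: p) =
  (multi_step ls m c).1 :: multi_run ls (multi_step ls m c).2 p.
Proof.
elim: ls => //= a ls IHls /andP[a_ls /IHls->] /=; rewrite eqxx.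
congr (_ :: (ball_run _ _ _).1); apply: eq_multi_run => b b_ls /=.
by case: eqP => // ba; rewrite -ba b_ls in a_ls.
Qed.

(* The letter [x] is the largest carried one below [c], cyclically, exactly as
   in [combR_spec]. *)
Lemma multi_step_spec ls m c :
  path (fun y z => y < z) one ls ->
  let x := (multi_step ls m c).1 in let m' := (multi_step ls m c).2 in
  {in ls, forall z, m' z + (x == z) = m z + (c == z)} /\
  if (c == one) || (c \in ls) then
    (x = one \/ [/\ x \in ls, 0 < m x & (c == one) || (x < c)]) /\
    {in ls, forall y, 0 < m y -> (c == one) || (y < c) -> y <= x}
  else x = c.
Proof.
elim: ls => [|a ls IHls] /=.
  by move=> _; split=> //; rewrite orbF; case: eqP => // ->; split=> //; left.
case/andP=> lt_1a a_ls.
have /allP a_lt : all (fun z : letter n => a < z) ls.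
  by apply: order_path_min a_ls => ? ? ?; apply: ltn_trans.
have lt_ls : path (fun y z : letter n => y < z) one ls.
  case: ls a_ls {IHls a_lt} => //= z ls /andP[az ->].
  by rewrite (ltn_trans lt_1a az).
have neq_lt y z : y < z -> (y == z) = false.
  by rewrite ltn_neqAle -val_eqE => /andP[/negPf].
have a_ne : {in ls, forall z, (a == z) = false /\ (one == z) = false}.
  by move=> z /a_lt az; rewrite !neq_lt // (ltn_trans lt_1a).
have aNls : a \notin ls by apply/negP => /a_lt; rewrite ltnn.
have [] := IHls lt_ls; move: (multi_step ls m c) => [x1 m1] /= mE xE.
have [ca|ca] := eqVneq c a.
  have x1a : x1 = a by move: xE; rewrite ca (negPf aNls) eq_sym neq_lt.
  rewrite /ball_step x1a eqxx /= inE ca eqxx orbT; split; last first.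
    split; first by left.
    move=> y; rewrite inE (eq_sym a) (neq_lt one) //= => /predU1P[->|/a_lt ay] _.
      by rewrite ltnn.
    by rewrite ltnNge ltnW.
  move=> z; rewrite inE => /predU1P[->|z_ls].
    by rewrite eqxx neq_lt //; lia.
  have [az z1] := a_ne z z_ls; have := mE z z_ls.
  by rewrite x1a ca az z1 eq_sym az.
have x1a : x1 != a.
  move: xE; case: ifP => [_ [[->|[x1_ls _ _]] _]|_ -> //].
    by rewrite neq_lt.
  by apply: contraNneq aNls => <-.
rewrite /ball_step (negPf x1a) inE (negPf ca) /=.
(* A letter [x1] other than 1 and [a] passes the carrier of [a]; if a larger colour emitted it, it
   stays maximal because [a] is smaller. If [x1] is 1, no eligible larger colour is carried, and [a]
   is the next candidate. *)
have [x11|x11] := eqVneq x1 one; last first.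
  split.
    move=> z; rewrite inE => /predU1P[->|z_ls].
      by rewrite eqxx (negPf x1a) (negPf ca).
    by have [az _] := a_ne z z_ls; rewrite eq_sym az mE.
  move: xE => /=; case: ifP => //= _ [xE x_max].
  case: xE x11 => [->|[x1_ls mx1 cx1] x11]; first by rewrite eqxx.
  split; first by right; rewrite inE x1_ls orbT.
  move=> y; rewrite inE => /predU1P[-> _ _|]; last exact: x_max.
  by rewrite ltnW ?a_lt.
have cE : (c == one) || (c \in ls).
  by move: xE; case: ifP => // + cx; rewrite -cx x11 eqxx.
rewrite cE in xE *; case: xE => _ x_max; rewrite x11 in x_max mE *.
have ca_lt : (c == one) || (a < c).
  by case/orP: cE => [-> //|/a_lt->]; rewrite orbT.
case: posnP => [ma0|ma_gt0] /=.
  split.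
    move=> z; rewrite inE => /predU1P[->|z_ls].
      by rewrite eqxx neq_lt // (negPf ca).
    by have [az _] := a_ne z z_ls; rewrite eq_sym az mE.
  split; first by left.
  by move=> y; rewrite inE => /predU1P[->|]; [rewrite ma0 | apply: x_max].
split.
  move=> z; rewrite inE => /predU1P[->|z_ls].
    by rewrite !eqxx (negPf ca); lia.
  have [az z1] := a_ne z z_ls; have := mE z z_ls.
  by rewrite (eq_sym z) az z1.
split; first by right; rewrite mem_head.
move=> y; rewrite inE => /predU1P[-> //|y_ls my cy].
by have := x_max y y_ls my cy; rewrite leqNgt (leq_ltn_trans _ (a_lt y y_ls)).
Qed.

End Machines.

(** * The one-row carrier as a composition of one-colour carriers *)

Section Simulation.
Variable n : nat.
Implicit Types (x y z a c : letter n) (s t p q ls : seq (letter n)).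

(** At most one letter 1 leaves per step, so the bound on [size p] keeps a 1 in the carrier
    throughout. Then every [c] other than 1 finds a smaller carried letter, and both rules emit the
    largest letter of the same set. *)
Lemma path_out_multi_run l (v : crystal n 1 l) ls m p :
  path (fun y z => y < z) one ls -> (forall a, a != one -> a \in ls) ->
  size p <= count_mem one (row v) ->
  (forall a, a != one -> count_mem a (row v) = m a) ->
  path_out v p = multi_run ls m p.
Proof.
move=> lt_ls ls_all; elim: p v m => [|c p IHp] v m.
  by elim: ls {lt_ls ls_all} => //= a ls IHls v1 vm; rewrite -IHls.
move=> le_p vm /=; have one_v : one \in row v.
  by rewrite -has_pred1 has_count; apply: leq_trans _ le_p.
have l_gt0 : 0 < l.
  by rewrite -(size_row v); apply: leq_trans (leq_trans _ le_p) (count_size _ _).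
have uniq_ls : uniq ls.
  apply: (sorted_uniq (leT := fun y z : letter n => y < z)); 
    last exact: path_sorted lt_ls.
    by move=> ? ? ?; apply: ltn_trans.
  by move=> ?; apply: ltnn.
have lt1 a : a != one -> one < a by rewrite -val_eqE /= lt0n.
rewrite multi_run_cons //; have := multi_step_spec m c lt_ls.
have := combR_spec v c l_gt0.
move: (combR v c) (multi_step ls m c) => [x w] [x' m'] /= [vw x_v x_max] [mE xE].
have xx' : x = x'.
  apply: val_inj; apply/eqP; rewrite eqn_leq; apply/andP.
  move: xE; rewrite (_ : _ || _ = true); last by case: eqP => // /eqP /ls_all.
  case=> x'E x'_max; split.
    have [->//|x1] := eqVneq x one; apply: x'_max; first exact: ls_all.
      by rewrite -vm // -has_count has_pred1.
    have [//|c1] := eqVneq c one.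
    have := x_max x x_v; rewrite ifT; first by case.
    by apply/hasP; exists one => //; apply: lt1.
  case: x'E => [->//|[x'_ls mx' cx']].
  have [->//|x'1] := eqVneq x' one.
  have x'_v : x' \in row v by rewrite -has_pred1 has_count vm.
  have := x_max x' x'_v; have [c1|c1] := eqVneq c one.
    by rewrite ifN // c1; apply/hasPn.
  rewrite ifT; last by apply/hasP; exists one => //; apply: lt1.
  by case=> _; apply; move: cx'; rewrite (negPf c1).
rewrite -xx' in mE *; congr (_ :: _); apply: IHp => [|a a1].
  have /permP/(_ (pred1 one)) /= := vw.
  move: le_p => /=; lia.
have /permP/(_ (pred1 a)) /= := vw.
have := mE a (ls_all a a1); rewrite vm //; lia.
Qed.

(** If the output is a rearrangement of [p], this forces the carrier to end with its initial
    content. *)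
Lemma carrier_out_perm l (v : crystal n 1 l) p : 0 < l ->
  perm_eq (path_out v p ++ row (carrier_out v p)) (p ++ row v).
Proof.
move=> l_gt0; elim: p v => //= c p IHp v.
have [vw _ _] := combR_spec v c l_gt0; move: vw (IHp (combR v c).2).
move: (combR v c) => [x w] /= vw /permP IH; apply/permP => P; have /permP/(_ P) := vw.
have := IH P; rewrite /= !count_cat; lia.
Qed.
End Simulation.

(** * Cyclic successors in a sorted list of positions *)

Lemma next_nth_sorted (s : seq nat) u : sorted ltn s -> u < size s ->
  next s (nth 0 s u) = nth 0 s (if u.+1 < size s then u.+1 else 0).
Proof.
move=> s_sorted lt_u; rewrite next_nth mem_nth //.
have s_uniq : uniq s by apply: sorted_uniq s_sorted; [apply: ltn_trans | apply: ltnn].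
case: s s_uniq lt_u {s_sorted} => // y s s_uniq lt_u.
rewrite index_uniq //; case: ifP => /= [lt_Su|]; first exact: set_nth_default.
by rewrite ltnS => /negbT; rewrite -leqNgt => ?; rewrite nth_default.
Qed.

Definition cyclic_between i k j :=
  if i < j then i < k < j else (i < k) || (k < j).

(** Positions in a sorted list compare as their indices do, and no index lies between consecutive
    ones, or beyond the last or before the first. *)
Lemma next_not_between (s : seq nat) i k : sorted ltn s ->
  i \in s -> k \in s -> ~~ cyclic_between i k (next s i).
Proof.
move=> s_sorted /(nthP 0)[u lt_u <-] /(nthP 0)[v lt_v <-].
rewrite next_nth_sorted //.
have mono w1 w2 : w1 < size s -> w2 < size s -> (nth 0 s w1 < nth 0 s w2) = (w1 < w2).
  move=> lt1 lt2; have mono12 := sorted_ltn_nth ltn_trans 0 s_sorted.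
  have [lt12|lt21|->] := ltngtP w1 w2; last exact: ltnn.
    exact: mono12.
  by apply/negbTE; rewrite -leqNgt ltnW //; apply: mono12.
have lt_w : (if u.+1 < size s then u.+1 else 0) < size s.
  by case: ifP => // _; apply: leq_ltn_trans lt_u.
rewrite /cyclic_between !mono //; case: (ltnP u.+1 (size s)) => [_|le_s] /=.
  by rewrite ltnSn; lia.
by rewrite orbF -leqNgt -ltnS (leq_trans lt_v).
Qed.

(** Iterating [next] from [x] visits all of [s]: rotated to start at [x], the list is a path along
    which [P] propagates. *)
Lemma all_of_next (T : eqType) (s : seq T) (P : pred T) x : uniq s ->
  x \in s -> P x -> {in s, forall y, P y -> P (next s y)} -> all P s.
Proof.
move=> s_uniq xs Px P_next; have := cycle_next s_uniq.
have [u s' rot_s] := rot_to xs; rewrite -(rot_cycle u) rot_s /= => s'_path.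
rewrite -(eq_all_r (mem_rot u s)) rot_s /= Px /=.
have: all [in s] (x :: s').
  by rewrite -rot_s; apply/allP => y; rewrite mem_rot.
move: s'_path; rewrite rcons_path => /andP[+ _].
elim: s' x Px {xs rot_s} => //= y s' IHs' x Px /andP[/eqP <- path_s'].
case/and3P=> xs ys s's; rewrite (P_next x xs Px) /=.
by apply: IHs' path_s' _; rewrite /= ?ys ?P_next.
Qed.

(** * The arcs of [K] and the one-colour carrier *)

Section Arcs.
Variables (n : nat) (a : letter n) (q : seq (letter n)).
Hypothesis a1 : a != one.
Hypothesis le_a1 : count_mem a q <= count_mem one q.
Implicit Types (arcs : seq (nat * nat)) (c : letter n).

Local Notation letter_at := (nth one q).

Definition positions c : seq nat :=
  [seq i <- iota 0 (size q) | letter_at i == c].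

Lemma size_positions c : size (positions c) = count_mem c q.
Proof.
rewrite size_filter -(count_map letter_at (pred1 c)).
by rewrite map_nth_iota0 // take_size.
Qed.

Lemma mem_positions c i : (i \in positions c) = (letter_at i == c) && (i < size q).
Proof. by rewrite mem_filter mem_iota. Qed.

Lemma mem_unconnected arcs i :
  (i \in unconnected a q arcs) =
  [&& letter_at i \in [:: one; a], i \notin unzip1 arcs ++ unzip2 arcs & i < size q].
Proof. by rewrite mem_filter mem_iota /= andbA. Qed.

Lemma unconnected_sorted arcs : sorted ltn (unconnected a q arcs).
Proof. exact/(sorted_filter ltn_trans)/iota_ltn_sorted. Qed.

(* By the last clause, the carrier of colour [a] is empty at each 1 that stays
   unconnected. *)
Definition good_arcs arcs : Prop :=
  [/\ uniq (unzip1 arcs), uniq (unzip2 arcs),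
      {in arcs, forall ij, (ij.1 \in positions a) && (ij.2 \in positions one)} &
      {in arcs, forall ij, {in unconnected a q arcs, forall k,
         ~~ cyclic_between ij.1 k ij.2}}].

Lemma good_arcs_sources arcs : good_arcs arcs -> {subset unzip1 arcs <= positions a}.
Proof. by case=> _ _ arcsE _ _ /mapP[ij /arcsE/andP[? _] ->]. Qed.

Lemma good_arcs_targets arcs : good_arcs arcs -> {subset unzip2 arcs <= positions one}.
Proof. by case=> _ _ arcsE _ _ /mapP[ij /arcsE/andP[_ ?] ->]. Qed.

(** Old arcs stay good because the unconnected positions only decrease; a new arc joins cyclic
    neighbours among them, so none lies inside it. New targets are distinct because [next] is
    injective. *)
Lemma connect_adjacent_good arcs :
  good_arcs arcs -> good_arcs (connect_adjacent a q arcs).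
Proof.
case=> uniq1 uniq2 arcsE arcs_btw; rewrite /connect_adjacent.
have s_sorted := unconnected_sorted arcs.
have sE := mem_unconnected arcs.
have sub_s : {subset unconnected a q (connect_adjacent a q arcs) <= unconnected a q arcs}.
  move=> i; rewrite !mem_unconnected /connect_adjacent /unzip1 /unzip2 !map_cat !mem_cat.
  by rewrite !negb_or => /and3P[-> /andP[/andP[-> _] /andP[-> _]] ->].
rewrite /connect_adjacent in sub_s.
move: s_sorted sE sub_s; set s := unconnected a q arcs => s_sorted sE sub_s.
have s_uniq : uniq s by apply: sorted_uniq s_sorted; [apply: ltn_trans | apply: ltnn].
set f := [seq i <- s | _] in sub_s *.
have f_s i : i \in f -> [/\ i \in s, letter_at i == a & letter_at (next s i) == one].
  by rewrite mem_filter => /andP[/andP[]].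
have f_uniq : uniq f by apply: filter_uniq s_uniq.
have z1 : unzip1 [seq (i, next s i) | i <- f] = f by rewrite /unzip1 -map_comp map_id.
have z2 : unzip2 [seq (i, next s i) | i <- f] = [seq next s i | i <- f].
  by rewrite /unzip2 -map_comp.
split.
- rewrite /unzip1 map_cat -!/(unzip1 _) z1 cat_uniq uniq1 f_uniq andbT /=.
  apply/hasPn => i /f_s[]; rewrite sE mem_cat negb_or.
  by case/and3P=> _ /andP[].
- rewrite /unzip2 map_cat -!/(unzip2 _) z2 cat_uniq uniq2 /=.
  rewrite map_inj_uniq ?f_uniq ?andbT; last exact: can_inj (prev_next s_uniq).
  apply/hasPn => _ /mapP[i /f_s[i_s _ _] ->].
  by move: i_s; rewrite -mem_next sE mem_cat negb_or => /and3P[_ /andP[]].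
- move=> ij; rewrite mem_cat => /orP[/arcsE //|/mapP[i /f_s[i_s ia j1] ->]] /=.
  rewrite !mem_positions ia j1 /=.
  have := i_s; rewrite sE => /and3P[_ _ ->].
  by have := i_s; rewrite -mem_next sE => /and3P[].
move=> ij; rewrite mem_cat => /orP[ij_arcs k /sub_s|/mapP[i /f_s[i_s _ _] -> k /sub_s ks]].
  exact: arcs_btw.
exact: next_not_between.
Qed.

(** Some [a] and some 1 are still unconnected. Without a new arc, the successor of each unconnected
    [a] would again be [a], and going round the cycle would leave no unconnected 1. *)
Lemma connect_adjacent_progress arcs : good_arcs arcs ->
  size arcs < count_mem a q -> size arcs < size (connect_adjacent a q arcs).
Proof.
move=> arcs_good lt_arcs; have [uniq1 uniq2 arcsE _] := arcs_good.
have exists_free c t : size t < count_mem c q -> exists2 i, i \in positions c & i \notin t.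
  move=> lt_t; suff /allPn[i] : ~~ all [in t] (positions c) by exists i.
  apply: contraL lt_t => /allP pos_t; rewrite -leqNgt -size_positions.
  by apply: uniq_leq_size pos_t; rewrite filter_uniq ?iota_uniq.
have [i0 i0_a i0_free] : exists2 i, i \in positions a & i \notin unzip1 arcs.
  by apply: exists_free; rewrite size_map.
have [j0 j0_1 j0_free] : exists2 j, j \in positions one & j \notin unzip2 arcs.
  by apply: exists_free; rewrite size_map (leq_trans lt_arcs).
have disj i : i \in positions a -> i \notin positions one.
  by rewrite !mem_positions => /andP[/eqP-> _]; rewrite (negPf a1).
have i0_s : i0 \in unconnected a q arcs.
  have := i0_a; rewrite mem_positions mem_unconnected => /andP[/eqP-> ->].
  rewrite !inE eqxx orbT mem_cat negb_or i0_free /= andbT.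
  by apply: contra (disj _ i0_a); apply: good_arcs_targets.
have j0_s : j0 \in unconnected a q arcs.
  have := j0_1; rewrite mem_positions mem_unconnected => /andP[/eqP-> ->].
  rewrite mem_head mem_cat negb_or j0_free /= !andbT.
  by apply: contraL j0_1 => /(good_arcs_sources arcs_good)/disj.
rewrite /connect_adjacent size_cat size_map -[ltnLHS]addn0 ltn_add2l size_filter -has_count.
apply: contraT => /hasPn no_pair.
have s_uniq : uniq (unconnected a q arcs) by rewrite filter_uniq ?iota_uniq.
have /allP/(_ j0 j0_s) /= : all (fun i => letter_at i == a) (unconnected a q arcs).
  apply: (all_of_next s_uniq i0_s); first by move: i0_a; rewrite mem_positions => /andP[].
  move=> i i_s ia; have := no_pair i i_s; rewrite ia /= => not1.
  move: (i_s); rewrite -mem_next mem_unconnected !inE (negPf not1) /=.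
  by case/and3P.
by move: j0_1; rewrite mem_positions => /andP[/eqP-> _]; rewrite eq_sym (negPf a1).
Qed.

Lemma all_arcs_good :
  good_arcs (all_arcs a q) /\ {subset positions a <= unzip1 (all_arcs a q)}.
Proof.
rewrite /all_arcs.
(* The induction runs over the number of rounds: after [k] of them there are at least
   [minn k (count_mem a q)] arcs. *)
have [good_k size_k] : good_arcs (iter (size q) (connect_adjacent a q) [::]) /\
  minn (size q) (count_mem a q) <= size (iter (size q) (connect_adjacent a q) [::]).
  elim: (size q) => [|k [good_k size_k]] /=; first by rewrite min0n; split.
  split; first exact: connect_adjacent_good.
  have := connect_adjacent_progress good_k.
  have : size (iter k (connect_adjacent a q) [::]) <=
         size (connect_adjacent a q (iter k (connect_adjacent a q) [::])).
    by rewrite [leqRHS]size_cat leq_addr.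
  move: size_k; move: (size (connect_adjacent _ _ _)) (size _) (count_mem _ _).
  lia.
split=> // i ia; move: size_k; rewrite (minn_idPr (count_size _ _)) -size_positions.
apply: contraLR => i_free; rewrite -ltnNge.
have [uniq1 _ _ _] := good_k.
rewrite -(size_map fst) -[X in X <= _]/(size (i :: unzip1 _)).
apply: uniq_leq_size; first by rewrite /= i_free.
by move=> k; rewrite inE => /predU1P[->//|]; apply: good_arcs_sources.
Qed.

(** The state just before position [k] is read, hence strict at the source and weak at the target.
    An arc that wraps around the end is open both at 0 and at [size q]. *)
Definition arc_open k (ij : nat * nat) : bool :=
  if ij.1 < ij.2 then ij.1 < k <= ij.2 else (k <= ij.2) || (ij.1 < k).

Definition open_arcs k := count (arc_open k) (all_arcs a q).

Lemma open_arcs_step k :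
  open_arcs k.+1 + (k \in unzip2 (all_arcs a q)) =
  open_arcs k + (k \in unzip1 (all_arcs a q)).
Proof.
have [[uniq1 uniq2 arcsE _] _] := all_arcs_good.
(* As sources and targets are distinct, memberships become counts, and the equation can be summed
   arc by arc. *)
rewrite -!count_uniq_mem // !count_map /open_arcs.
have: all (fun ij : nat * nat => ij.1 != ij.2) (all_arcs a q).
  apply/allP => ij /arcsE; rewrite !mem_positions; case: (ij.1 =P ij.2) => // ->.
  by case/andP=> /andP[/eqP-> _]; rewrite (negPf a1).
elim: (all_arcs a q) => //= -[i j] arcs IH /andP[/= ij /IH]; rewrite /arc_open /=.
by have [] := ltngtP i j; lia.
Qed.

Lemma open_arcs_cyclic : open_arcs (size q) = open_arcs 0.
Proof.
have [[_ _ arcsE _] _] := all_arcs_good; apply: eq_in_count => -[i j] /arcsE /=.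
rewrite !mem_positions /arc_open /= => /andP[/andP[_ lt_i] /andP[_ lt_j]].
by case: (ltnP i j) => _; lia.
Qed.

Lemma ball_step_open_arcs k : k < size q ->
  ball_step a (open_arcs k) (letter_at k) = (nth one (K a q) k, open_arcs k.+1).
Proof.
move=> lt_k; rewrite (nth_map 0) ?size_iota // nth_iota // add0n.
have [good all_a] := all_arcs_good; have := open_arcs_step k.
have := good_arcs_sources good (x := k); have := good_arcs_targets good (x := k).
have := all_a k; rewrite !mem_positions lt_k !andbT /ball_step.
have [ka|ka] := eqVneq (letter_at k) a.
  move=> /(_ isT) -> + _; rewrite ka (negPf a1).
  case: (k \in unzip2 _) => [/(_ isT)//|_]; rewrite addn0 addn1 => ->.
  by [].
move=> _ k2 k1; case: (boolP (k \in unzip1 _)) k1 => [_ /(_ isT)//|k1 _].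
rewrite addn0; case: (boolP (k \in unzip2 _)) k2 => [_ /(_ isT) -> /=|k2 _].
  by rewrite addn1 => <-.
rewrite addn0 => openE; have [k_1|k_1] /= := eqVneq (letter_at k) one; last by rewrite openE.
(* This is an unconnected 1. An arc open here does not end at [k], so [k] would lie strictly inside
   it, against the last clause of [good_arcs]. *)
suff open0 : open_arcs k = 0 by rewrite openE open0 /= k_1.
apply/eqP; rewrite eqn0Ngt -has_count; apply/hasPn => -[i j] ij.
have [_ _ _ /(_ _ ij k)] := good.
rewrite mem_unconnected k_1 mem_head mem_cat negb_or k1 k2 lt_k => /(_ isT).
have : k != j by apply: contraNneq k2 => ->; apply: (map_f snd ij).
move=> /negPf kj; rewrite /cyclic_between /arc_open /= [k <= j]leq_eqVlt kj /=.
by rewrite [(k < j) || _]orbC.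
Qed.

Lemma ball_run_K : ball_run a (open_arcs 0) q = (K a q, open_arcs 0).
Proof.
rewrite -[in RHS]open_arcs_cyclic.
have : size (K a q) = size q by rewrite size_map size_iota.
(* Only the stepwise relation is kept, for an arbitrary output word and counter, so that the
   induction may shift positions by one. *)
move: (K a q) (open_arcs) (ball_step_open_arcs).
elim: q => [|c p IHp] [|x r] //= M step [sz].
have := step 0 isT; rewrite /= => ->.
by rewrite (IHp r (fun k => M k.+1)) // => k lt_k; apply: (step k.+1).
Qed.
End Arcs.

(** * All colours together, and the fixed carrier *)

Lemma letters_path n :
  path (fun y z : letter n => y < z) one [seq a <- enum 'I_n.+1 | a != one].
Proof.
have lt_trans : transitive (fun y z : letter n => y < z).
  by move=> ? ? ?; apply: ltn_trans.
rewrite path_sortedE //; apply/andP; split.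
  by apply/allP => a; rewrite mem_filter -val_eqE /= lt0n => /andP[].
apply: sorted_filter => //.
by have := iota_ltn_sorted 0 n.+1; rewrite -val_enum_ord sorted_map.
Qed.

(** [m a] is the number of open arcs at 0 in the word that [K a] receives. Each [K a] permutes its
    word, so the inequality between the counts of [a] and 1 passes on to the next colour. *)
Lemma foldr_K_multi_run n (ls p : seq (letter n)) :
  uniq ls -> all (predC1 one) ls -> in_B1 p ->
  exists2 m, multi_run ls m p = foldr (fun a q => K a q) p ls &
             perm_eq (foldr (fun a q => K a q) p ls) p.
Proof.
move=> + + p_B1; elim: ls => [|a ls IHls] /=; first by exists (fun=> 0).
case/andP=> a_ls ls_uniq /andP[a1 ls1].
have [m mE qp] := IHls ls_uniq ls1; move: (foldr _ _ ls) mE qp => q mE qp.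
have le_q : count_mem a q <= count_mem one q by rewrite !(permP qp).
have runE := ball_run_K a1 le_q; move: (open_arcs a q 0) runE => k runE.
exists (fun z => if z == a then k else m z).
  rewrite eqxx (eq_multi_run (m' := m)) ?mE ?runE //= => b b_ls.
  by case: eqP b_ls a_ls => // -> ->.
by rewrite (perm_trans _ qp) // -[K a q]/((K a q, k).1) -runE ball_run_perm ?runE.
Qed.

Lemma count_mem_flatten_nseq (T : eqType) (ls : seq T) (m : T -> nat) a :
  uniq ls -> a \in ls ->
  count_mem a (flatten [seq nseq (m b) b | b <- ls]) = m a.
Proof.
move=> ls_uniq a_ls; rewrite count_flatten sumnE !big_map (bigD1_seq a) //=.
rewrite count_nseq /= eqxx mul1n big1 ?addn0 // => b /negPf ba.
by rewrite count_nseq /= ba.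
Qed.

Theorem theorem2p1 (n L : nat) (hn : 1 <= n) (hL : 1 <= L)
    (p : L.-tuple (letter n)) (hp : in_B1 p) (hev : Tinf_evolvable p) :
  Tinf_eq p (K_all p).
Proof.
have [l0 ev_p] := hev.
have lt_ls := letters_path n; rewrite /K_all; set ls := filter _ _ in lt_ls *.
have ls_uniq : uniq ls by rewrite filter_uniq ?enum_uniq.
have ls1 : all (predC1 one) ls by apply: filter_all.
have ls_all a : a != one -> a \in ls by rewrite mem_filter mem_enum => ->.
have [m mE Kp] := foldr_K_multi_run ls_uniq ls1 hp.
pose balls := flatten [seq nseq (m a) a | a <- ls].
(* The second bound leaves room for at least [L] letters 1 in the carrier, one for each letter of
   [p]. *)
exists (maxn l0 (size balls + L)) => l; rewrite geq_max => /andP[le_l0 le_l].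
pose s := nseq (l - size balls) one ++ balls.
have [||v vE] := @row_surj n l (sort (@leL n) s).
- rewrite size_sort size_cat size_nseq; lia.
- by apply: sort_sorted => y z; apply: leq_total.
have vs : perm_eq (row v) s by rewrite vE perm_sort.
have v_out : path_out v p = foldr (fun a q => K a q) p ls.
  rewrite -mE; apply: path_out_multi_run => //.
    by rewrite size_tuple (permP vs) count_cat count_nseq /=; lia.
  move=> a a1; rewrite (permP vs) count_cat count_nseq /= eq_sym (negPf a1).
  by rewrite count_mem_flatten_nseq ?ls_all.
have l_gt0 : 0 < l by lia.
have v_fix : v = carrier_out v p.
  apply: row_inj; apply: (sorted_eq (@leL_trans n)); try exact: row_sorted.
    by move=> y z /anti_leq /val_inj.
  (* The output permutes [p], so the initial and final rows have the same content; being sorted,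
     they coincide. *)
  have := carrier_out_perm v p l_gt0; rewrite v_out perm_sym => vp.
  by rewrite -(perm_cat2l p) (perm_trans vp) // perm_cat2r.
rewrite /evolve; case: pickP => [w /eqP w_fix|/(_ v)]; last by rewrite -v_fix eqxx.
by have [_ /(_ _ _ w_fix v_fix)[->]] := ev_p l le_l0.
Qed.
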